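(* Let $\mathfrak g$ be a stratified Lie algebra and let $k\ge0$ be an integer. Then $\mathfrak g$ is hypergenerated of order $k$ if and only if the Lie algebra $\mathfrak g/\mathfrak g^3$ is hypergenerated of order $k$.
   Context: A stratified Lie algebra of step $s$ is a finite-dimensional real nilpotent Lie algebra with a decomposition $\mathfrak g=V_1\oplus\dots\oplus V_s$ such that $[V_1,V_i]=V_{i+1}$ for $1\le i\le s-1$, $V_s\ne\{0\}$, $[V_1,V_s]=\{0\}$; its rank is $m=\dim V_1$. It is hypergenerated of order $k$ if every linear subspace $P\subseteq V_1$ with $\dim P=m-k$ satisfies $[\mathfrak g,\mathfrak g]\subseteq\mathrm{Lie}(P)$, where $\mathrm{Lie}(P)$ is the smallest Lie subalgebra of $\mathfrak g$ containing $P$. The lower central series is $\mathfrak g^1=\mathfrak g$, $\mathfrak g^{h+1}=[\mathfrak g,\mathfrak g^h]$. The quotient $\mathfrak g/\mathfrak g^3\cong V_1\oplus V_2$ is a stratified Lie algebra with the induced stratification. *)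

(* Defs.v *)
From HB Require Import structures.
From mathcomp Require Import all_boot all_order all_algebra.
From mathcomp Require Import reals.
From mathcomp Require Import zify.

Set Implicit Arguments.
Unset Strict Implicit.
Unset Printing Implicit Defensive.

Import GRing.Theory.
Local Open Scope ring_scope.

HB.mixin Record Vector_isLieAlgebra (K : fieldType) (g : Type)
    of Vector K g := {
  lie : g -> g -> g;
  lie_linearl : forall z : g, linear (lie^~ z);
  lie_linearr : forall x : g, linear (lie x);
  liexx : forall x : g, lie x x = 0;
  lie_jacobi : forall x y z : g,
    lie x (lie y z) + lie y (lie z x) + lie z (lie x y) = 0
}.

#[short(type="lieAlgType")]
HB.structure Definition LieAlgebra (K : fieldType) :=
  { g of Vector_isLieAlgebra K g & Vector K g }.

Section LieTheory.
Variables (K : fieldType) (g : lieAlgType K).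
Implicit Types (x y z : g) (U V W P L S : {vspace g}).

HB.instance Definition _ x :=
  GRing.isLinear.Build K g g *:%R (lie x) (lie_linearr x).

Definition lier z : g -> g := fun x => lie x z.

HB.instance Definition _ z :=
  GRing.isLinear.Build K g g *:%R (lier z) (lie_linearl z).

Lemma lieC x y : lie x y = - lie y x.
Proof.
have := liexx (x + y); rewrite linearD /= -!/(lier _ (x + y)) !linearD /=.
rewrite /lier !liexx add0r addr0 => /eqP.
by rewrite addrC addr_eq0 => /eqP.
Qed.

Lemma lie_lie x y z : lie (lie x y) z = lie x (lie y z) - lie y (lie x z).
Proof.
have /eqP := lie_jacobi x y z.
rewrite [lie z (lie x y)]lieC subr_eq0 => /eqP <-.
by rewrite [lie z x]lieC linearN.
Qed.

(* As for [prodv] on algebras: the span of all brackets, see [lie_prodP]. *)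
Definition lie_prod U V : {vspace g} :=
  <<[seq lie u v | u <- vbasis U, v <- vbasis V]>>%VS.

Lemma memv_lie U V : {in U & V, forall u v, lie u v \in lie_prod U V}.
Proof.
move=> u v Uu /coord_vbasis->; rewrite linear_sum /=.
apply: memv_suml => j _; rewrite linearZ /= memvZ //.
rewrite (coord_vbasis Uu) -/(lier _ _) linear_sum /=.
apply: memv_suml => i _; rewrite linearZ /= memvZ // /lier memv_span //.
by apply/allpairsP; exists ((vbasis U)`_i, (vbasis V)`_j); rewrite !memt_nth.
Qed.

Lemma lie_prodP {U V W} :
  reflect {in U & V, forall u v, lie u v \in W} (lie_prod U V <= W)%VS.
Proof.
apply: (iffP idP) => [sUVW u v Uu Vv | sUVW].
  by rewrite (subvP sUVW) ?memv_lie.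
apply/span_subvP=> _ /allpairsP[[u v] /= [Uu Vv ->]].
by rewrite sUVW ?vbasis_mem.
Qed.

Lemma lie_prodS U1 U2 V1 V2 :
  (U1 <= U2)%VS -> (V1 <= V2)%VS -> (lie_prod U1 V1 <= lie_prod U2 V2)%VS.
Proof.
move=> /subvP sU /subvP sV; apply/lie_prodP=> u v /sU Uu /sV Vv.
exact: memv_lie.
Qed.

Definition is_subalgebra L := (lie_prod L L <= L)%VS.

Definition is_smallest_subalgebra P L : Prop :=
  [/\ is_subalgebra L, (P <= L)%VS
    & forall S, is_subalgebra S -> (P <= S)%VS -> (L <= S)%VS].

Lemma smallest_subalgebra_exists P : {L | is_smallest_subalgebra P L}.
Proof.
suff minex n L : (P <= L)%VS ->
    (forall S, is_subalgebra S -> (P <= S)%VS -> (L <= S)%VS) ->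
    (\dim {:g} - \dim L < n)%N -> {L | is_smallest_subalgebra P L}.
  by apply: (minex _ P) (ltnSn _).
elim: n L => // n IHn L sPL minL.
have [algL _ | nalgL ltn] := boolP (is_subalgebra L); first by exists L.
have sLL' : (L <= L + lie_prod L L)%VS by apply: addvSl.
have ltL : (\dim L < \dim (L + lie_prod L L))%N.
  rewrite ltn_neqAle dimvS // andbT; apply: contra nalgL => /eqP eqd.
  have /eqP eqL : L == (L + lie_prod L L)%VS by rewrite eqEdim sLL' -eqd leqnn.
  by rewrite /is_subalgebra [X in (_ <= X)%VS]eqL addvSr.
apply: (IHn (L + lie_prod L L)%VS).
- exact: subv_trans sLL'.
- move=> S algS sPS; rewrite subv_add minL //=.
  by apply: subv_trans (algS); apply: lie_prodS; apply: minL.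
- rewrite ltnS in ltn; apply: leq_trans ltn; rewrite ltn_sub2l //.
  exact: leq_trans ltL (dimvS (subvf _)).
Qed.

Definition lie_gen P : {vspace g} := sval (smallest_subalgebra_exists P).

Lemma lie_genP P : is_smallest_subalgebra P (lie_gen P).
Proof. exact: svalP (smallest_subalgebra_exists P). Qed.

(* [lcs h] is $g^h$ for [h >= 1]; [lcs 0] is a dummy value. *)
Definition lcs (h : nat) : {vspace g} := iter h.-1 (lie_prod fullv) fullv.

Definition is_nilpotent : Prop := exists h, lcs h = 0%VS.

Lemma lcsS h : (0 < h)%N -> lcs h.+1 = lie_prod fullv (lcs h).
Proof. by case: h. Qed.

Lemma lcs_leS h : (lcs h.+1 <= lcs h)%VS.
Proof.
case: h => // h; elim: h => [|h IHh]; first exact: subvf.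
exact: lie_prodS (subvv _) IHh.
Qed.

End LieTheory.

Section LieQuotient.
Variables (K : fieldType).

Record lie_ideal (g : lieAlgType K) := LieIdeal {
  ideal_vs :> {vspace g};
  ideal_closed : (lie_prod fullv ideal_vs <= ideal_vs)%VS
}.

Lemma lcs_ideal_closed (g : lieAlgType K) h :
  (lie_prod fullv (lcs g h) <= lcs g h)%VS.
Proof. by case: h => [|h]; [exact: subvf | rewrite -lcsS // lcs_leS]. Qed.

Definition lcs_ideal g h : lie_ideal g := LieIdeal (lcs_ideal_closed g h).

Variables (g : lieAlgType K) (I : lie_ideal g).

Definition lie_quot := Quotient.quot (pred_of_vspace (ideal_vs I)).
HB.instance Definition _ := GRing.Zmodule.on lie_quot.

Definition quot_proj (x : g) : lie_quot :=
  \pi_(Quotient.quot (pred_of_vspace (ideal_vs I)))%qT x.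

Definition quot_repr (q : lie_quot) : g := repr q.

Lemma quot_reprK : cancel quot_repr quot_proj.
Proof. by move=> q; rewrite /quot_proj /quot_repr reprK. Qed.

Lemma quot_projP x y : reflect (quot_proj x = quot_proj y) (x - y \in ideal_vs I).
Proof.
apply: (iffP idP) => [xyI | eqxy].
  by apply/eqP; rewrite -Quotient.idealrBE.
by rewrite Quotient.idealrBE; apply/eqP.
Qed.

Lemma quot_projD x y : quot_proj (x + y) = quot_proj x + quot_proj y.
Proof. exact: Quotient.pi_add. Qed.

Lemma quot_repr_proj x : quot_repr (quot_proj x) - x \in ideal_vs I.
Proof. by apply/quot_projP; rewrite quot_reprK. Qed.

Definition quot_scale (a : K) (q : lie_quot) := quot_proj (a *: quot_repr q).

Lemma quot_projZ a x : quot_proj (a *: x) = quot_scale a (quot_proj x).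
Proof.
by apply/esym/quot_projP; rewrite -scalerBr memvZ // quot_repr_proj.
Qed.

Fact quot_scaleA a b q : quot_scale a (quot_scale b q) = quot_scale (a * b) q.
Proof. by rewrite -[q]quot_reprK -!quot_projZ scalerA. Qed.
Fact quot_scale1 : left_id 1 quot_scale.
Proof. by move=> q; rewrite -[q]quot_reprK -!quot_projZ scale1r. Qed.
Fact quot_scaleDr : right_distributive quot_scale +%R.
Proof.
move=> a p q; rewrite -[p]quot_reprK -[q]quot_reprK.
by rewrite -quot_projD -!quot_projZ scalerDr quot_projD.
Qed.
Fact quot_scaleDl q : {morph quot_scale^~ q : a b / a + b}.
Proof.
by move=> a b /=; rewrite -[q]quot_reprK -!quot_projZ scalerDl quot_projD.
Qed.

HB.instance Definition _ := GRing.Zmodule_isLmodule.Build K lie_quot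
  quot_scaleA quot_scale1 quot_scaleDr quot_scaleDl.

Fact quot_proj_linear : linear quot_proj.
Proof. by move=> a x y; rewrite quot_projD quot_projZ. Qed.
HB.instance Definition _ :=
  GRing.isLinear.Build K g lie_quot *:%R quot_proj quot_proj_linear.

Fact lie_quot_vect_axiom : Vector.axiom (\dim (ideal_vs I)^C) lie_quot.
Proof.
pose J := (ideal_vs I)^C%VS; pose b := vbasis J; pose p := daddv_pi J I.
have dJI : (J :&: I = 0)%VS by rewrite capvC capv_compl.
have dIJ : (I :&: J = 0)%VS by rewrite capv_compl.
have pE x : x - p x \in ideal_vs I.
  have xJI : x \in (J + I)%VS by rewrite addvC addv_complf memvf.
  by rewrite -{1}(daddv_pi_add dJI xJI) addrC addrA addNr add0r memv_pi.
have p0 x : x \in ideal_vs I -> p x = 0.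
  move=> Ix; apply/eqP; rewrite -memv0 -dJI memv_cap memv_pi /=.
  by rewrite -[p x](subKr x) memvB // pE.
have pR x : p (quot_repr (quot_proj x)) = p x.
  by apply/eqP; rewrite -subr_eq0 -(linearB p) /= (p0 _ (quot_repr_proj x)).
exists (fun q => \row_i coord b i (p (quot_repr q))).
  move=> a q r; rewrite -[q]quot_reprK -[r]quot_reprK -linearP !pR.
  by apply/rowP=> i; rewrite !mxE !linearP.
exists (fun v : 'rV_(\dim J) => quot_proj (\sum_i v 0 i *: b`_i)) => [q|v].
  rewrite -{2}[q]quot_reprK; apply/esym/quot_projP.
  rewrite [X in _ - X](_ : _ = p (quot_repr q)) //.
  rewrite {2}(coord_vbasis (memv_pi J I (quot_repr q))).
  by apply: eq_bigr => i _; rewrite mxE.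
apply/rowP=> i; rewrite mxE pR /p daddv_pi_id //.
  by rewrite coord_sum_free ?(basis_free (vbasisP J)).
by apply: rpred_sum => j _; rewrite rpredZ ?vbasis_mem ?memt_nth.
Qed.
HB.instance Definition _ := Lmodule_hasFinDim.Build K lie_quot lie_quot_vect_axiom.

Definition quot_lie (p q : lie_quot) : lie_quot :=
  quot_proj (lie (quot_repr p) (quot_repr q)).

Lemma quot_proj_lie x y :
  quot_proj (lie x y) = quot_lie (quot_proj x) (quot_proj y).
Proof.
have idr u v : v \in ideal_vs I -> lie u v \in ideal_vs I.
  by move=> Iv; apply: (lie_prodP (ideal_closed I)); rewrite ?memvf.
apply/esym/quot_projP.
set x' := quot_repr _; set y' := quot_repr _.
have -> : lie x' y' - lie x y = lie x' (y' - y) - lie y (x' - x).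
  rewrite !linearB /= [lie y x']lieC [lie y x]lieC opprK.
  by rewrite opprK addrA addrNK.
by rewrite memvB // idr // quot_repr_proj.
Qed.

Fact quot_lie_linearl r : linear (quot_lie^~ r).
Proof.
move=> a p q; rewrite -[p]quot_reprK -[q]quot_reprK -[r]quot_reprK.
by rewrite -linearP -!quot_proj_lie lie_linearl linearP.
Qed.
Fact quot_lie_linearr p : linear (quot_lie p).
Proof.
move=> a q r; rewrite -[p]quot_reprK -[q]quot_reprK -[r]quot_reprK.
by rewrite -linearP -!quot_proj_lie lie_linearr linearP.
Qed.
Fact quot_liexx p : quot_lie p p = 0.
Proof. by rewrite -[p]quot_reprK -quot_proj_lie liexx linear0. Qed.
Fact quot_lie_jacobi p q r :
  quot_lie p (quot_lie q r) + quot_lie q (quot_lie r p)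
    + quot_lie r (quot_lie p q) = 0.
Proof.
rewrite -[p]quot_reprK -[q]quot_reprK -[r]quot_reprK -!quot_proj_lie.
by rewrite -!quot_projD lie_jacobi linear0.
Qed.

HB.instance Definition _ := Vector_isLieAlgebra.Build K lie_quot
  quot_lie_linearl quot_lie_linearr quot_liexx quot_lie_jacobi.

Definition quot_hom : 'Hom(g, lie_quot) := linfun quot_proj.

Lemma quot_homE x : quot_hom x = quot_proj x.
Proof. exact: lfunE. Qed.

Lemma quot_hom_lie x y : quot_hom (lie x y) = lie (quot_hom x) (quot_hom y).
Proof. by rewrite !quot_homE quot_proj_lie. Qed.

Lemma limg_quot_hom : limg quot_hom = fullv.
Proof.
apply/vspaceP=> q; rewrite memvf -[q]quot_reprK -quot_homE.
by rewrite memv_img ?memvf.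
Qed.

Lemma lker_quot_hom : lker quot_hom = ideal_vs I.
Proof.
apply/vspaceP=> x; rewrite memv_ker quot_homE -(linear0 quot_proj).
by rewrite -[x in RHS]subr0; apply/eqP/quot_projP.
Qed.

Lemma limg_lie_prod U V :
  (quot_hom @: lie_prod U V)%VS = lie_prod (quot_hom @: U) (quot_hom @: V).
Proof.
apply/eqP; rewrite eqEsubv; apply/andP; split.
  apply/subvP=> _ /memv_imgP[x xUV ->]; rewrite memv_preim.
  apply: subvP xUV; apply/lie_prodP=> u v Uu Vv.
  by rewrite -memv_preim quot_hom_lie memv_lie ?memv_img.
apply/lie_prodP=> _ _ /memv_imgP[u Uu ->] /memv_imgP[v Vv ->].
by rewrite -quot_hom_lie memv_img ?memv_lie.
Qed.

Lemma limg_lcs h : (quot_hom @: lcs g h)%VS = lcs lie_quot h.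
Proof.
case: h => [|h]; first exact: limg_quot_hom.
elim: h => [|h IHh]; first exact: limg_quot_hom.
by rewrite (@lcsS _ g h.+1) // limg_lie_prod IHh limg_quot_hom.
Qed.

Lemma quot_nilpotent : is_nilpotent g -> is_nilpotent lie_quot.
Proof. by case=> h gh0; exists h; rewrite -limg_lcs gh0 limg0. Qed.

End LieQuotient.

(* Only [layer i] for [1 <= i <= step] is meaningful. *)
Record stratifiedLie (K : fieldType) := StratifiedLie {
  strat_carrier :> lieAlgType K;
  step : nat;
  layer : nat -> {vspace strat_carrier};
  strat_nilpotent : is_nilpotent strat_carrier;
  step_gt0 : (0 < step)%N;
  layer_direct : directv (\sum_(i < step) layer i.+1)%VS;
  layer_sum : (\sum_(i < step) layer i.+1)%VS = fullv;
  layerS : forall i, (0 < i < step)%N ->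
    lie_prod (layer 1) (layer i) = layer i.+1;
  layer_step_neq0 : layer step != 0%VS;
  layer_step_lie : lie_prod (layer 1) (layer step) = 0%VS
}.

Section StratTheory.
Variables (K : fieldType) (g : stratifiedLie K).

Let layer0 i : {vspace g} :=
  if (0 < i <= step g)%N then layer g i else 0%VS.

Let tail n : {vspace g} := (\sum_(n <= i < step g) layer g i.+1)%VS.

Let mem_layer0 i u : (0 < i)%N -> u \in layer0 i ->
  u = 0 \/ (i <= step g)%N /\ u \in layer g i.
Proof.
rewrite /layer0 => ->; case: ifP => [? ?|_]; first by right.
by rewrite memv0 => /eqP; left.
Qed.

Let lie_layer1 j u v : (0 < j)%N ->
  u \in layer g 1 -> v \in layer0 j -> lie u v \in layer0 j.+1.
Proof.
move=> j0 Vu /(mem_layer0 j0)[->|[les Vv]]; first by rewrite linear0 mem0v.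
have := memv_lie Vu Vv; rewrite /layer0 /=.
move: les; rewrite leq_eqVlt => /predU1P[ejs|ltjs].
  by rewrite ejs layer_step_lie ltnn.
by rewrite ltjs layerS // j0.
Qed.

Let lie_layer0 i j u v : (0 < i)%N -> (0 < j)%N ->
  u \in layer0 i -> v \in layer0 j -> lie u v \in layer0 (i + j).
Proof.
case: i => // i _; elim: i j u v => [|i IHi] j u v j0.
  by rewrite {1}/layer0 step_gt0 add1n => ? ?; apply: lie_layer1.
move=> /(@mem_layer0 i.+2 _ isT)[->|[les Vu]] Vv.
  by rewrite -/(lier _ _) linear0 mem0v.
move: Vu; rewrite -layerS //.
pose f := linfun (lier v).
suff /subvP sub : (lie_prod (layer g 1) (layer g i.+1)
                   <= f @^-1: layer0 (i.+2 + j))%VS.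
  by move=> /sub; rewrite -memv_preim lfunE.
apply/lie_prodP=> a b Va Vb; rewrite -memv_preim lfunE /= /lier lie_lie.
have Vb0 : b \in layer0 i.+1 by rewrite /layer0 /= (ltnW les).
rewrite memvB //.
  by rewrite !addSn -addSn; apply: lie_layer1; rewrite ?addSn // IHi.
rewrite addSn -addnS; apply: IHi => //.
exact: lie_layer1.
Qed.

Let tail_layer0 n i u : (n < i)%N -> u \in layer0 i -> u \in tail n.
Proof.
move=> ltni /mem_layer0[|->|[les Vu]]; rewrite ?mem0v //.
  exact: leq_ltn_trans ltni.
case: i ltni les Vu => // i leni ltis Vu.
rewrite /tail big_geq_mkord; apply: subvP Vu.
exact: (sumv_sup (Ordinal ltis)).
Qed.

Let layer_layer0 i u : (0 < i <= step g)%N -> u \in layer g i -> u \in layer0 i.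
Proof. by rewrite /layer0 => ->. Qed.

Let lie_tail n u v : v \in tail n -> lie u v \in tail n.+1.
Proof.
have : u \in fullv by rewrite memvf.
rewrite -layer_sum => /memv_sumP[us Vus ->].
rewrite {1}/tail big_geq_mkord => /memv_sumP[vs Vvs ->].
rewrite linear_sum; apply: memv_suml => j lenj /=.
rewrite -/(lier _ _) linear_sum; apply: memv_suml => i _ /=; rewrite /lier.
have Vi : us i \in layer0 i.+1 by apply: layer_layer0; rewrite ?ltn_ord ?Vus.
have Vj : vs j \in layer0 j.+1 by apply: layer_layer0; rewrite ?ltn_ord ?Vvs.
apply: tail_layer0 (lie_layer0 _ _ Vi Vj) => //.
by rewrite addSn addnS !ltnS (leq_trans lenj) ?leq_addl.
Qed.

Lemma lcs_sub_tail n : (lcs g n.+1 <= \sum_(n <= i < step g) layer g i.+1)%VS.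
Proof.
rewrite -/(tail n).
elim: n => [|n IHn]; first by rewrite /tail big_mkord layer_sum subvf.
rewrite (@lcsS _ g n.+1) //; apply/lie_prodP=> u v _ /(subvP IHn).
exact: lie_tail.
Qed.

Lemma layer_sub_lcs i : (0 < i <= step g)%N -> (layer g i <= lcs g i)%VS.
Proof.
case: i => // i /=; elim: i => [|i IHi] ltis; first exact: subvf.
rewrite -layerS; last by rewrite -ltnS.
by rewrite (@lcsS _ g i.+1) // lie_prodS ?subvf // IHi // ltnW.
Qed.

Lemma lcs_leq i j : (i <= j)%N -> (lcs g j <= lcs g i)%VS.
Proof.
move=> /subnKC <-; elim: (j - i)%N => [|n IHn]; first by rewrite addn0.
by rewrite addnS (subv_trans (lcs_leS _ _)).
Qed.

Lemma tail_sub_lcs n : (\sum_(n <= i < step g) layer g i.+1 <= lcs g n.+1)%VS.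
Proof.
rewrite big_geq_mkord; apply/subv_sumP=> i leni.
apply: subv_trans (lcs_leq (_ : n.+1 <= i.+1)%N) => //.
by rewrite layer_sub_lcs /=.
Qed.

Lemma layer_split n : (n <= step g)%N ->
  [/\ directv (\sum_(i < n) layer g i.+1)%VS,
      ((\sum_(i < n) layer g i.+1) + tail n)%VS = fullv
    & ((\sum_(i < n) layer g i.+1) :&: tail n)%VS = 0%VS].
Proof.
move=> lens; pose V i := layer g i.+1.
have sumE : ((\sum_(i < n) V i) + tail n)%VS = fullv.
  rewrite -layer_sum -(big_mkord xpredT V) -(big_mkord xpredT V).
  by rewrite -(big_cat_nat _ lens).
have dimE : (\dim {:g} = \sum_(i < n) \dim (V i)
                       + \sum_(n <= i < step g) \dim (V i))%N.
  have /directvP/= := layer_direct g; rewrite layer_sum => ->.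
  rewrite -(big_mkord xpredT (fun i => \dim (V i))).
  rewrite -(big_mkord xpredT (fun i => \dim (V i))).
  exact: big_cat_nat.
have leA : (\dim (\sum_(i < n) V i)%VS <= \sum_(i < n) \dim (V i))%N.
  exact: dimv_leq_sum.
have leB : (\dim (tail n) <= \sum_(n <= i < step g) \dim (V i))%N.
  by rewrite /tail !big_geq_mkord; exact: dimv_leq_sum.
have capE := dimv_sum_cap (\sum_(i < n) V i)%VS (tail n).
rewrite sumE dimE in capE.
have {capE} [cap0 eqA] : \dim ((\sum_(i < n) V i) :&: tail n) = 0%N
    /\ \dim (\sum_(i < n) V i)%VS = (\sum_(i < n) \dim (V i))%N.
  by split; move: leA leB capE; lia.
split=> //; first by apply/directvP.
by apply/eqP; rewrite -dimv_eq0 cap0.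
Qed.

End StratTheory.

Section StratQuotient.
Variables (K : fieldType) (g : stratifiedLie K).

(* $g/g^3$, stratified by the images of the layers of $g$; those of index at
   least 3 vanish, and the step is 1 rather than 2 when $g$ is abelian. *)
Definition quot3 : lieAlgType K := lie_quot (lcs_ideal g 3).

Definition quot3_layer i : {vspace quot3} :=
  (quot_hom (lcs_ideal g 3) @: layer g i)%VS.

Definition quot3_step : nat := minn (step g) 2.
Local Notation s2 := quot3_step.
Let pi := quot_hom (lcs_ideal g 3).

Let ker_tail : (lker pi <= \sum_(s2 <= i < step g) layer g i.+1)%VS.
Proof.
rewrite lker_quot_hom /=; apply: subv_trans (lcs_sub_tail g 2) _.
rewrite /quot3_step /minn; case: ifP => // lts.
by rewrite !big_geq // ltnW.
Qed.

Let cap_ker U : (U <= \sum_(i < s2) layer g i.+1)%VS -> (U :&: lker pi = 0)%VS.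
Proof.
move=> sU; apply/eqP; rewrite -subv0.
have [_ _ <-] := layer_split (geq_minl (step g) 2).
exact: capvS.
Qed.

Let layer_sub i : (0 < i <= s2)%N ->
  (layer g i <= \sum_(i < s2) layer g i.+1)%VS.
Proof. by case: i => // i lti; apply: (sumv_sup (Ordinal lti)). Qed.

Fact quot3_step_gt0 : (0 < s2)%N.
Proof. by rewrite leq_min step_gt0. Qed.

Fact quot3_direct : directv (\sum_(i < s2) quot3_layer i.+1)%VS.
Proof.
have [/directvP/= dA _ _] := layer_split (geq_minl (step g) 2).
apply/directvP; rewrite /= -limg_sum limg_dim_eq ?cap_ker // dA.
by apply: eq_bigr => i _; rewrite limg_dim_eq ?cap_ker ?layer_sub /= ?ltn_ord.
Qed.

Fact quot3_sum : (\sum_(i < s2) quot3_layer i.+1)%VS = fullv.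
Proof.
have [_ sumE _] := layer_split (geq_minl (step g) 2).
rewrite -limg_sum -[RHS]limg_quot_hom -sumE limgD.
rewrite [X in (_ + X)%VS](_ : _ = 0%VS) ?addv0 //; apply/eqP.
rewrite -lkerE lker_quot_hom /=.
rewrite /quot3_step /minn; case: ifP => // lts; last exact: tail_sub_lcs.
by rewrite big_geq ?sub0v.
Qed.

Fact quot3_layerS i : (0 < i < s2)%N ->
  lie_prod (quot3_layer 1) (quot3_layer i) = quot3_layer i.+1.
Proof.
move=> /andP[i0]; rewrite leq_min => /andP[lti _].
by rewrite -limg_lie_prod layerS // i0.
Qed.

Fact quot3_step_neq0 : quot3_layer s2 != 0%VS.
Proof.
rewrite -dimv_eq0 limg_dim_eq; last first.
  by rewrite cap_ker ?layer_sub ?quot3_step_gt0 /=.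
rewrite dimv_eq0; apply: contra (layer_step_neq0 g) => /eqP V0.
have les : (s2 <= step g)%N by apply: geq_minl.
rewrite -(subnKC les); have := leqnn (step g - s2).
elim: {1 3}(step g - s2)%N => [|m IHm] lem; first by rewrite addn0 V0.
rewrite addnS -layerS; last first.
  by have := quot3_step_gt0; move: lem les; lia.
have /eqP-> := IHm (ltnW lem).
rewrite -subv0; apply/lie_prodP=> u v _.
by rewrite memv0 => /eqP->; rewrite linear0 mem0v.
Qed.

Fact quot3_step_lie : lie_prod (quot3_layer 1) (quot3_layer s2) = 0%VS.
Proof.
rewrite -limg_lie_prod; apply/eqP; rewrite -lkerE lker_quot_hom /=.
rewrite /quot3_step /minn; case: ifP => lts.
  by rewrite layer_step_lie sub0v.
rewrite (@lcsS _ g 2) // lie_prodS ?subvf // layer_sub_lcs //.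
by rewrite /= leqNgt lts.
Qed.

Definition strat_quot3 : stratifiedLie K :=
  @StratifiedLie K quot3 quot3_step quot3_layer
    (quot_nilpotent (lcs_ideal g 3) (strat_nilpotent g)) quot3_step_gt0 quot3_direct quot3_sum
    quot3_layerS quot3_step_neq0 quot3_step_lie.

End StratQuotient.

Definition rank (K : fieldType) (g : stratifiedLie K) : nat := \dim (layer g 1).

(* [\dim P = rank g - k] is read in the integers: no subspace qualifies when
   [k > rank g], whereas truncated subtraction would select [P = 0]. *)
Definition hypergenerated (K : fieldType) (g : stratifiedLie K) (k : nat) :=
  forall P : {vspace g}, (P <= layer g 1)%VS -> (\dim P + k)%N = rank g ->
  (lie_prod {:g} {:g} <= lie_gen P)%VS.

(* Main.v *)
(* Modulo $g^3$ every $P \subseteq V_1$ generates just $P + [P, P]$, so by the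
   grading hypergeneration of $g/g^3$ gives $V_2 = [P, P]$.  This already
   forces $[g, g] \subseteq Lie(P)$: by the Jacobi identity,
   $[V_1, [P, V_{i-1}]] \subseteq [V_2, V_{i-1}] + [P, V_i]$ with
   $[V_2, V_{i-1}] = [[P, P], V_{i-1}] \subseteq [P, V_i]$, so inductively
   $V_{i+1} = [P, V_i]$ for all $i \ge 1$. *)
Require Import Defs.
From mathcomp Require Import all_boot all_order all_algebra.
From mathcomp Require Import reals.

Set Implicit Arguments.
Unset Strict Implicit.
Unset Printing Implicit Defensive.

Import GRing.Theory.
Local Open Scope ring_scope.

Section LieLemmas.
Variables (K : fieldType) (g : lieAlgType K).
Implicit Types (U V W P S : {vspace g}).

Lemma lie_prodDl U V W :
  (lie_prod (U + V) W <= lie_prod U W + lie_prod V W)%VS.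
Proof.
apply/lie_prodP=> _ w /memv_addP[u Uu [v Vv ->]] Ww.
by rewrite -/(lier w _) linearD memv_add ?memv_lie.
Qed.

Lemma lie_prodDr U V W :
  (lie_prod U (V + W) <= lie_prod U V + lie_prod U W)%VS.
Proof.
apply/lie_prodP=> u _ Uu /memv_addP[v Vv [w Ww ->]].
by rewrite linearD memv_add ?memv_lie.
Qed.

Lemma lie_prodC U V : lie_prod U V = lie_prod V U.
Proof.
by apply/eqP; rewrite eqEsubv; apply/andP; split;
  apply/lie_prodP=> u v Uu Vv; rewrite lieC memvN memv_lie.
Qed.

(** By the Jacobi identity each [lie u] is a derivation; this is the resulting Leibniz rule for
    subspaces. *)
Lemma lie_prodA_sub U V W :
  (lie_prod U (lie_prod V W)
    <= lie_prod (lie_prod U V) W + lie_prod V (lie_prod U W))%VS.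
Proof.
apply/lie_prodP=> u x Uu; pose f := linfun (lie u).
suff /subvP sVW : (lie_prod V W <= f @^-1: (lie_prod (lie_prod U V) W
                                  + lie_prod V (lie_prod U W)))%VS.
  by move=> /sVW; rewrite -memv_preim lfunE.
apply/lie_prodP=> v w Vv Ww; rewrite -memv_preim lfunE /=.
have -> : lie u (lie v w) = lie (lie u v) w + lie v (lie u w).
  by rewrite lie_lie subrK.
by rewrite memv_add ?memv_lie.
Qed.

Lemma lie_gen_min P S : is_subalgebra S -> (P <= S)%VS -> (lie_gen P <= S)%VS.
Proof. by case: (lie_genP P) => _ _; apply. Qed.

Lemma lie_gen_sub P : (P <= lie_gen P)%VS.
Proof. by case: (lie_genP P). Qed.

Lemma lie_prod_gen P U V : (U <= lie_gen P)%VS -> (V <= lie_gen P)%VS ->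
  (lie_prod U V <= lie_gen P)%VS.
Proof.
by case: (lie_genP P) => algL _ _ sU sV; apply: subv_trans algL; apply: lie_prodS.
Qed.

(** When triple brackets vanish, $[P, P]$ is central, so $P + [P, P]$ is already a subalgebra. *)
Lemma lie_gen_step2 P : lcs g 3 = 0%VS -> (lie_gen P <= P + lie_prod P P)%VS.
Proof.
move=> g30; apply: lie_gen_min (addvSl _ _).
have cent U : lie_prod U (lie_prod P P) = 0%VS.
  apply/eqP; rewrite -subv0 -g30.
  exact: lie_prodS (subvf _) (lie_prodS (subvf _) (subvf _)).
apply: subv_trans (lie_prodDr _ _ _) _; rewrite cent addv0.
apply: subv_trans (lie_prodDl _ _ _) _.
by rewrite [X in (_ + X)%VS]lie_prodC cent addv0 addvSr.
Qed.

(** The preimage of a subalgebra under the quotient map is a subalgebra, so the minimality of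
    [lie_gen P] applies to it. *)
Lemma limg_lie_gen (I : lie_ideal g) P :
  (quot_hom I @: lie_gen P <= lie_gen (quot_hom I @: P))%VS.
Proof.
set L := lie_gen (quot_hom I @: P).
have [algL sPL _] := lie_genP (quot_hom I @: P).
have /subvP sL : (lie_gen P <= quot_hom I @^-1: L)%VS.
  apply: lie_gen_min.
    apply/lie_prodP=> u v; rewrite -!memv_preim quot_hom_lie => Lu Lv.
    exact: (lie_prodP algL).
  by apply/subvP=> x Px; rewrite -memv_preim (subvP sPL) ?memv_img.
by apply/subvP=> _ /memv_imgP[x /sL + ->]; rewrite -memv_preim.
Qed.

End LieLemmas.

Section Stratified.
Variables (K : fieldType) (g : stratifiedLie K).
Implicit Types P : {vspace g}.
Local Notation pi := (quot_hom (lcs_ideal g 3)).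

Lemma layer1_cap_lcs3 : (layer g 1 :&: lcs g 3)%VS = 0%VS.
Proof.
have [_ _] := layer_split (step_gt0 g); rewrite big_ord1 => cap0.
apply/eqP; rewrite -subv0 -cap0 capvS //.
exact: subv_trans (lcs_leS _ _) (lcs_sub_tail g 1).
Qed.

(** The kernel $g^3$ meets $V_1$ trivially, so the projection is injective there; this transfers the
    codimension condition on $P$. *)
Lemma dim_limg_layer1 P : (P <= layer g 1)%VS -> \dim (pi @: P) = \dim P.
Proof.
move=> sP; apply: limg_dim_eq; apply/eqP.
by rewrite -subv0 -layer1_cap_lcs3 lker_quot_hom capvS.
Qed.

Lemma rank_quot3 : rank (strat_quot3 g) = rank g.
Proof. exact: dim_limg_layer1 (subvv _). Qed.

Lemma limg_lie_prodf :
  (pi @: lie_prod fullv fullv)%VS = lie_prod fullv fullv.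
Proof. by rewrite limg_lie_prod limg_quot_hom. Qed.

Lemma layer2_lie_prod P : (1 < step g)%N -> (P <= layer g 1)%VS ->
  (lie_prod {:quot3 g} {:quot3 g} <= lie_gen (pi @: P))%VS ->
  layer g 2 = lie_prod P P.
Proof.
move=> step2 sP gen; have V2E : lie_prod (layer g 1) (layer g 1) = layer g 2.
  by rewrite layerS.
have sPP : (lie_prod P P <= layer g 2)%VS by rewrite -V2E lie_prodS.
have [_ _] := layer_split (step_gt0 g); rewrite big_ord1 => cap1.
have [_ _] := layer_split step2; rewrite !big_ord_recl big_ord0 addv0 /= => cap2.
apply/eqP; rewrite eqEsubv sPP andbT; apply/subvP=> v V2v.
have g'30 : lcs (quot3 g) 3 = 0%VS.
  by rewrite -limg_lcs; apply/eqP; rewrite -lkerE lker_quot_hom.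
have : pi v \in (pi @: (P + lie_prod P P))%VS.
  rewrite limgD limg_lie_prod; apply: subvP (lie_gen_step2 _ g'30) _ _.
  apply: (subvP gen); rewrite -limg_lie_prodf memv_img //.
  by move: V2v; rewrite -V2E; apply/subvP/lie_prodS; rewrite subvf.
case/memv_imgP=> _ /memv_addP[p Pp [w PPw ->]] pivE.
have V1p := subvP sP _ Pp; have V2w := subvP sPP _ PPw.
(* This difference lies in $V_1 + V_2$ and in the kernel $g^3$, which is contained in the sum of the
   layers from the third on. *)
have vpw0 : v - (p + w) = 0.
  apply/eqP; rewrite -memv0 -cap2 memv_cap; apply/andP; split.
    by rewrite memvB ?memv_add // -[v]add0r memv_add ?mem0v.
  apply: subvP (lcs_sub_tail g 2) _ _.
  have : v - (p + w) \in lker pi by rewrite memv_ker linearB /= pivE subrr.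
  by rewrite lker_quot_hom.
(* Now $p = v - w$ lies in both $V_1$ and $V_2$. *)
have p0 : p = 0.
  apply/eqP; rewrite -memv0 -cap1 memv_cap V1p /=.
  have -> : p = v - w by move/eqP: vpw0; rewrite subr_eq0 => /eqP ->; rewrite addrK.
  by rewrite big_ltn // -[v - w]addr0 memv_add ?mem0v ?memvB.
by move/eqP: vpw0; rewrite p0 add0r subr_eq0 => /eqP ->.
Qed.

Lemma layerS_lie_prod P i : (P <= layer g 1)%VS -> layer g 2 = lie_prod P P ->
  (0 < i < step g)%N -> (layer g i.+1 <= lie_prod P (layer g i))%VS.
Proof.
move=> sP V2E; case: i => // i /=; elim: i => [|i IHi] lti.
  by rewrite V2E lie_prodS.
have sPV j : (0 < j < step g)%N -> (lie_prod P (layer g j) <= layer g j.+1)%VS.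
  by move=> ltj; rewrite -layerS // lie_prodS.
have lti' := ltnW lti.
rewrite -layerS //; apply: subv_trans (lie_prodS (subvv _) (IHi lti')) _.
(* Leibniz: $[V_1, [P, V_{i+1}]] \subseteq [[V_1, P], V_{i+1}] + [P, [V_1, V_{i+1}]]$. *)
apply: subv_trans (lie_prodA_sub _ _ _) _; rewrite subv_add; apply/andP; split.
  have sV1P : (lie_prod (layer g 1) P <= lie_prod P P)%VS.
    by rewrite -V2E -(@layerS _ g 1) ?lie_prodS //= (leq_trans _ lti).
  apply: subv_trans (lie_prodS sV1P (subvv _)) _.
  (* With $V_{i+1}$ as the outer factor, Leibniz turns $[V_{i+1}, [P, P]]$ into two terms, both
     equal to $[P, [P, V_{i+1}]]$ up to symmetry. *)
  rewrite lie_prodC; apply: subv_trans (lie_prodA_sub _ _ _) _.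
  rewrite lie_prodC subv_add; apply/andP; split;
    apply: lie_prodS (subvv _) _; rewrite 1?lie_prodC; exact: sPV.
by rewrite layerS ?lie_prodS.
Qed.

Lemma lie_prodf_sub_gen P : (P <= layer g 1)%VS -> layer g 2 = lie_prod P P ->
  (lie_prod {:g} {:g} <= lie_gen P)%VS.
Proof.
move=> sP V2E; apply: subv_trans (lcs_sub_tail g 1) _.
rewrite big_geq_mkord; apply/subv_sumP=> -[i /= lti] i0.
elim: i i0 lti => // i IHi _ lti.
(* The induction starts at $V_2 = [P, P]$, since $V_1$ itself need not lie in $Lie(P)$. *)
case: i IHi lti => [|i] IHi lti; first by rewrite V2E lie_prod_gen ?lie_gen_sub.
apply: subv_trans (layerS_lie_prod sP V2E _) _ => //.
by rewrite lie_prod_gen ?lie_gen_sub // IHi // ltnW.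
Qed.

End Stratified.

Theorem corollary3p4 (R : realType) (g : stratifiedLie R) (k : nat) :
  hypergenerated g k <-> hypergenerated (strat_quot3 g) k.
Proof.
pose pi := quot_hom (lcs_ideal g 3).
split=> hyp P sP dimP.
  (* The lift of $P$ to $V_1$, of the same dimension as $P$ by injectivity of [pi] on $V_1$. *)
  pose Q := (layer g 1 :&: pi @^-1: P)%VS.
  have piQ : (pi @: Q)%VS = P.
    apply/vspaceP=> y; apply/memv_imgP/idP => [[x + ->]|Py].
      by rewrite memv_cap -memv_preim => /andP[].
    have /memv_imgP[x V1x yE] := subvP sP _ Py.
    by exists x; rewrite // memv_cap V1x -memv_preim /= /pi -yE.
  have sQ : (Q <= layer g 1)%VS by apply: capvSl.
  rewrite -piQ; apply: subv_trans (limg_lie_gen _ _).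
  rewrite -limg_lie_prodf limgS // hyp //.
  by rewrite -(dim_limg_layer1 sQ) -/pi piQ dimP rank_quot3.
(* In step 1, $[g, g] = 0$; this case is separate because [layer g 2] is then an unconstrained
   value. *)
have [step1 | step2] := leqP (step g) 1.
  apply: subv_trans (lcs_sub_tail g 1) _.
  by rewrite big_geq // sub0v.
apply: lie_prodf_sub_gen => //; apply: layer2_lie_prod => //.
apply: hyp; first exact: limgS.
by rewrite dim_limg_layer1 // rank_quot3.
Qed.
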